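(* Let $s\geq 1$ be an integer and let $L$ be the subdivision of the $1$-simplex by $s$ interior vertices (a path with $s+1$ edges). Then for every $n\geq 0$ the generalized Tchebyshev polynomial of the first kind $T^L_n(x)$ has $n$ distinct real roots in the open interval $(-1,1)$.
   Context: Simplicial complexes are finite abstract simplicial complexes, containing the empty face. The link of a face $\sigma$ of $K$ is $\mathrm{link}_K(\sigma)=\{\tau\in K: \sigma\cap\tau=\emptyset,\ \sigma\cup\tau\in K\}$. $f_i(K)$ is the number of $i$-dimensional faces of $K$. The $F$-polynomial of $K$ is $F(K,x)=\sum_{j=0}^{\dim K+1} f_{j-1}(K)\left(\frac{x-1}{2}\right)^j$. Here $\partial(L)$ consists of the empty face and the two endpoints of the path $L$; $V(\partial(L))$ is the set of the two endpoints. A simplicial complex $K'$ is a generalized Tchebyshev triangulation of $K$ induced by $L$ if there is an ordered list $\sigma_1,\ldots,\sigma_m$ of the edges ($1$-dimensional faces) of $K$, listing each exactly once, bijections $\phi_{\sigma_i}:V(\partial(L))\to\sigma_i$, and simplicial complexes $K_0=K,K_1,\ldots,K_m=K'$ such that for each $i\geq 1$ the complex $K_i$ is obtained from $K_{i-1}$ as follows: take an isomorphic copy $L_i$ of $L$ in which each boundary vertex $w\in V(\partial(L))$ is identified with $\phi_{\sigma_i}(w)$ and the interior vertices are new vertices, and replace the family of faces $\{\sigma_i\cup\tau:\tau\in\mathrm{link}_{K_{i-1}}(\sigma_i)\}$ by the family $\{\sigma'\cup\tau:\sigma'\in L_i,\ \tau\in\mathrm{link}_{K_{i-1}}(\sigma_i)\}$.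 All generalized Tchebyshev triangulations of a given $K$ induced by $L$ have the same $f$-vector, hence the same $F$-polynomial, and there is a unique linear map $T^L:\mathbb{R}[x]\to\mathbb{R}[x]$ with $T^L(F(K,x))=F(K',x)$ for every simplicial complex $K$ and every generalized Tchebyshev triangulation $K'$ of $K$ induced by $L$. One defines $T^L_n(x):=T^L(x^n)$. *)

(* Defs.v *)
From HB Require Import structures.
From mathcomp Require Import all_boot all_order all_algebra.
From mathcomp Require Import finmap.
From mathcomp Require Import reals.
Set Implicit Arguments.
Unset Strict Implicit.
Unset Printing Implicit Defensive.
Import Order.TTheory GRing.Theory Num.Theory.
Local Open Scope fset_scope.
Local Open Scope ring_scope.

(* The vertices of K are the v with [fset v] \in K, not all of V. *)
Definition is_complex (V : choiceType) (K : {fset {fset V}}) : Prop :=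
  fset0 \in K /\
  forall sigma tau : {fset V}, sigma \in K -> tau `<=` sigma -> tau \in K.

Definition link (V : choiceType) (K : {fset {fset V}}) (sigma : {fset V}) :
    {fset {fset V}} :=
  [fset tau in K | (sigma `&` tau == fset0) && (sigma `|` tau \in K)].

(* dim K + 1 *)
Definition dim1 (V : choiceType) (K : {fset {fset V}}) : nat :=
  (\max_(sigma <- K) #|` sigma|)%N.

(* f_{j-1}(K): the faces of dimension j - 1 are those with j vertices. *)
Definition fnum (V : choiceType) (K : {fset {fset V}}) (j : nat) : nat :=
  #|` [fset sigma in K | #|` sigma| == j]|.

Definition Fpoly (R : realType) (V : choiceType) (K : {fset {fset V}}) :
    {poly R} :=
  \sum_(0 <= j < (dim1 K).+1) (fnum K j)%:R *: (2^-1 *: ('X - 1)) ^+ j.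

(* The path with s interior vertices: its vertices are 0, ..., s + 1 and its
   endpoints are 0 and s + 1. *)
Definition path_complex (s : nat) : {fset {fset nat}} :=
  fset0 |` ([fset [fset i] | i in iota 0 s.+2] `|`
            [fset [fset i; i.+1] | i in iota 0 s.+1]).

Definition path_copy (s : nat) (V : choiceType) (g : nat -> V) :
    {fset {fset V}} :=
  [fset [fset g i | i in rho] | rho : {fset nat} in path_complex s].

(* K' is obtained from K by subdividing sigma along a copy of the path.  The
   copy is the image of the path under the vertex labelling g; the restriction
   of g to {0, s + 1} is the bijection from the endpoints of the path onto
   sigma. *)
Definition edge_subdivision (s : nat) (V : choiceType)
    (K : {fset {fset V}}) (sigma : {fset V}) (K' : {fset {fset V}}) : Prop :=
  exists g : nat -> V,
    [/\ {in [pred i | (i <= s.+1)%N] &, injective g},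
        [fset g 0%N; g s.+1] = sigma,
        forall i : nat, (0 < i < s.+1)%N -> [fset g i] \notin K
      & K' = (K `\` [fset sigma `|` tau | tau in link K sigma]) `|`
             [fset sigma' `|` tau |
                sigma' in path_copy s g, tau in link K sigma]].

Definition tchebyshev_triangulation (s : nat) (V : choiceType)
    (K K' : {fset {fset V}}) : Prop :=
  exists (edges : seq {fset V}) (Ks : nat -> {fset {fset V}}),
    [/\ uniq edges,
        edges =i [fset sigma in K | #|` sigma| == 2%N],
        Ks 0%N = K /\ Ks (size edges) = K',
        forall i : nat, (i <= size edges)%N -> is_complex (Ks i)
      & forall i : nat, (i < size edges)%N ->
          edge_subdivision s (Ks i) (nth fset0 edges i) (Ks i.+1)].

(* The defining property of T^L; it determines T because the boundary complex
   of the n-dimensional cross-polytope has F-polynomial 'X^n. *)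
Definition tchebyshev_map (s : nat) (R : realType)
    (T : {linear {poly R} -> {poly R}}) : Prop :=
  forall (V : choiceType) (K K' : {fset {fset V}}),
    is_complex K -> tchebyshev_triangulation s K K' ->
    T (Fpoly R K) = Fpoly R K'.

(* Main.v *)
Require Import Defs.
From HB Require Import structures.
From mathcomp Require Import all_boot all_order all_algebra.
From mathcomp Require Import finmap.
From mathcomp Require Import reals.
From mathcomp Require Import zify ring lra.
Import Order.TTheory GRing.Theory Num.Theory.
Local Open Scope fset_scope.
Local Open Scope ring_scope.
Set Implicit Arguments.
Unset Strict Implicit.
Unset Printing Implicit Defensive.

(** At a point [x] of the interval from -1 to 1, the map [T] is
    p |-> Re p(x + i r), where r ^ 2 = s (1 - x ^ 2)
    ([tchebyshev_map_eval] says so for the powers of the variable).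

    Since T is linear, it is enough to see this on simplices, whose
    F-polynomials are the powers of (x + 1) / 2.  Put t = (x - 1) / 2, let P_n
    be the F-polynomial of the triangulated simplex on n vertices, and let Q_n
    be the sum of the F-polynomials of the links of its n original vertices.
    The simplex on n + 1 vertices is a cone over the one on n vertices.
    Subdivide its old edges first: subdivision commutes with coning
    ([cone_subdivide]), so this yields the cone over the triangulated simplex.
    By then no two original vertices of the base are adjacent, so the
    subdivisions of the n edges through the apex do not interfere with each
    other, and each of them adds s t (1 + t) times the F-polynomial of the link
    of its edge, which is the link of an original vertex in the base
    ([facepoly_subdivide]).  These subdivisions preserve the F-polynomials of
    the links of original vertices ([linkpoly_subdivide_far],
    [linkpoly_subdivide_end]).  In the cone, the link of the apex is the base
    and the other links are cones, with one more factor 1 + t.  Therefore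
      P_(n+1) = (1 + t) P_n + s t (1 + t) Q_n,   Q_(n+1) = (1 + t) Q_n + P_n
    ([simplex_tri_facepolyS], [orig_linkpolyS]).  As
    s t (1 + t) = - (r / 2) ^ 2, these are the real and imaginary parts of
      P_n + i (r / 2) Q_n = ((1 + x + i r) / 2) ^ n
    ([simplex_tri_eval]), and T(x ^ n) = Re ((x + i r) ^ n) follows by
    expanding x = 2 (x + 1) / 2 - 1.

    The points x + i r with r positive form the upper half of an ellipse.  In
    polar coordinates x + i r = rho e ^ (i a) with 0 < a < pi, the value at [x]
    of T(x ^ n) is rho ^ n cos (n a), which vanishes at the n angles
    (2 k + 1) pi / (2 n).  Their abscissas are distinct, because a point of the
    upper half ellipse is determined by its abscissa, and a nonzero polynomial
    of degree at most n has no other root. *)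

(** * Faces of a complex after the subdivision of one edge *)

(** The faces of the copy of the path that are not faces of the boundary of
    the subdivided edge: the interior vertices and the edges. *)
Definition new_cells (s : nat) (V : choiceType) (g : nat -> V) :
    seq {fset V} :=
  [seq [fset g i.+1] | i <- iota 0 s] ++
  [seq [fset g i; g i.+1] | i <- iota 0 s.+1].

Definition split_edge (s : nat) (V : choiceType) (g : nat -> V) : {fset V} :=
  [fset g 0%N; g s.+1].

Definition subdivide (s : nat) (V : choiceType) (K : {fset {fset V}})
    (g : nat -> V) : {fset {fset V}} :=
  (K `\` [fset split_edge s g `|` tau | tau in link K (split_edge s g)]) `|`
  [fset sigma `|` tau |
     sigma in path_copy s g, tau in link K (split_edge s g)].

Definition fresh_labels (s : nat) (V : choiceType) (K : {fset {fset V}})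
    (g : nat -> V) : Prop :=
  {in [pred i | (i <= s.+1)%N] &, injective g} /\
  forall i : nat, (0 < i < s.+1)%N -> [fset g i] \notin K.

Lemma path_complexP (s : nat) (rho : {fset nat}) :
  reflect [\/ rho = fset0,
              exists2 i, (i < s.+2)%N & rho = [fset i]
            | exists2 i, (i < s.+1)%N & rho = [fset i; i.+1]]
          (rho \in path_complex s).
Proof.
have iotaP n (f : nat -> {fset nat}) :
    reflect (exists2 i, (i < n)%N & rho = f i) (rho \in [fset f i | i in iota 0 n]).
  apply: (iffP (imfsetP _ _ _ _)) => -[i lti ->]; exists i => //.
    by have : i \in iota 0 n by []; rewrite mem_iota.
  by suff : i \in iota 0 n by []; rewrite mem_iota.
rewrite !in_fsetU in_fset1; apply: (iffP or3P).
  by case=> [/eqP | /iotaP | /iotaP];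
     [constructor 1 | constructor 2 | constructor 3].
by case=> [-> | /iotaP | /iotaP];
   [constructor 1 | constructor 2 | constructor 3].
Qed.

Lemma path_copyP (s : nat) (V : choiceType) (g : nat -> V) (c : {fset V}) :
  (c \in path_copy s g) =
  [|| c == fset0, c == [fset g 0%N], c == [fset g s.+1] | c \in new_cells s g].
Proof.
rewrite mem_cat; apply/imfsetP/idP => [[rho] + ->{c} | ].
  case/path_complexP => [-> | [i ltis ->] | [i ltis ->]].
  - by rewrite imfset0 eqxx.
  - rewrite imfset_fset1; case: i ltis => [|i]; first by rewrite eqxx !orbT.
    rewrite !ltnS leq_eqVlt => /predU1P[-> | ltis]; first by rewrite eqxx !orbT.
    apply/or4P/Or44/orP; left.
    by apply/mapP; exists i; rewrite // mem_iota.
  - rewrite imfset_fset2.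
    by apply/or4P/Or44/orP; right; apply/mapP; exists i; rewrite // mem_iota.
have vtx i : (i < s.+2)%N -> [fset i] \in path_complex s.
  by move=> lti; apply/path_complexP; constructor 2; exists i.
case/or4P => [/eqP-> | /eqP-> | /eqP-> | ].
- by exists fset0; rewrite ?imfset0 //; apply/path_complexP; constructor 1.
- by exists [fset 0%N]; rewrite ?imfset_fset1 //; apply: vtx.
- by exists [fset s.+1]; rewrite ?imfset_fset1 //; apply: vtx.
case/orP=> cN; have [i + ->] := mapP cN; rewrite mem_iota => ltis.
  by exists [fset i.+1]; rewrite ?imfset_fset1 //; apply: vtx; rewrite ltnS ltnW.
exists [fset i; i.+1]; rewrite ?imfset_fset2 //.
by apply/path_complexP; constructor 3; exists i.
Qed.

Lemma in_linkP (V : choiceType) (K : {fset {fset V}}) (sigma tau : {fset V}) :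
  reflect ([disjoint sigma & tau] /\ sigma `|` tau \in K /\ tau \in K)
          (tau \in link K sigma).
Proof.
rewrite !inE /= fsetI_eq0.
by apply: (iffP and3P) => [[] | [? []]].
Qed.

(** Turns sums over the faces containing [sigma], among them the faces that a
    subdivision removes, into sums over the link. *)
Lemma star_link (V : choiceType) (K : {fset {fset V}}) (sigma : {fset V}) :
  is_complex K ->
  perm_eq [seq rho <- K | sigma `<=` rho] [seq sigma `|` tau | tau <- link K sigma].
Proof.
move=> [_ Kdown]; apply: uniq_perm.
- exact/filter_uniq/fset_uniq.
- rewrite map_inj_in_uniq ?fset_uniq // => x y.
  move=> /in_linkP[dx _] /in_linkP[dy _] /(congr1 (fun r => r `\` sigma)).
  rewrite !fsetDUl fsetDv !fset0U.
  move: dx dy; rewrite ![[disjoint sigma & _]]fdisjoint_sym.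
  by move=> /fsetDidPl-> /fsetDidPl->.
move=> rho; rewrite mem_filter.
apply/andP/mapP => [[srho Krho] | [tau /in_linkP[_ [sK _]] ->]].
  exists (rho `\` sigma); last first.
    apply/fsetP => x; rewrite !inE.
    by case: (boolP (x \in sigma)) => // /(fsubsetP srho)->.
  apply/in_linkP; split; last split.
  - by apply/fdisjointP => x xs; rewrite !inE xs.
  - by apply: Kdown Krho _; rewrite fsubUset srho fsubsetDl.
  - by apply: Kdown Krho _; rewrite fsubsetDl.
by rewrite fsubsetUl.
Qed.

Lemma new_cell_label (s : nat) (V : choiceType) (g : nat -> V) (c : {fset V})
    (x : V) :
  c \in new_cells s g -> x \in c -> exists2 i, (i < s.+2)%N & x = g i.
Proof.
rewrite mem_cat => /orP[] /mapP[i]; rewrite mem_iota => /= lti ->; rewrite !inE.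
  by move=> /eqP->; exists i.+1; rewrite // ltnS ltnW.
by case/orP=> /eqP->; [exists i | exists i.+1]; rewrite // ltnW.
Qed.

Lemma new_cell_interior (s : nat) (V : choiceType) (g : nat -> V)
    (c : {fset V}) :
  (0 < s)%N -> c \in new_cells s g -> exists2 i, (0 < i < s.+1)%N & g i \in c.
Proof.
move=> s_gt0; rewrite mem_cat => /orP[] /mapP[i]; rewrite mem_iota => /= lti ->.
  by exists i.+1; rewrite ?inE.
case: i lti => [|i] lti; first by exists 1%N; rewrite ?inE ?eqxx ?orbT.
by exists i.+1; rewrite ?inE ?eqxx.
Qed.

Lemma new_cells_uniq (s : nat) (V : choiceType) (g : nat -> V) :
  {in [pred i | (i <= s.+1)%N] &, injective g} -> uniq (new_cells s g).
Proof.
move=> g_inj; rewrite cat_uniq; apply/and3P; split.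
- rewrite map_inj_in_uniq ?iota_uniq // => i j.
  rewrite !mem_iota => /= lti ltj /fset1_inj/g_inj; rewrite !inE => eq_ij.
  by have := eq_ij ltac:(lia) ltac:(lia); lia.
- apply/hasPn => _ /mapP[i + ->]; rewrite mem_iota => /= lti.
  apply/negP => /mapP[j _ /(congr1 (fun c => #|` c|))].
  rewrite cardfs1 cardfs2; case: eqP => [/g_inj|] //; rewrite !inE => eq_i.
  by have := eq_i ltac:(lia) ltac:(lia); lia.
- rewrite map_inj_in_uniq ?iota_uniq // => i j.
  rewrite !mem_iota => /= lti ltj eq_ij.
  have : g i \in [fset g j; g j.+1] by rewrite -eq_ij !inE eqxx.
  have : g j \in [fset g i; g i.+1] by rewrite eq_ij !inE eqxx.
  rewrite !inE => /orP[] /eqP/g_inj; rewrite !inE => ji.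
  all: case/orP=> /eqP/g_inj; rewrite !inE => ij.
  all: have := ji ltac:(lia) ltac:(lia); have := ij ltac:(lia) ltac:(lia); lia.
Qed.

Lemma complex_mem (V : choiceType) (K : {fset {fset V}}) (rho : {fset V})
    (x : V) :
  is_complex K -> rho \in K -> x \in rho -> [fset x] \in K.
Proof. by move=> [_ Kdown] Krho xr; apply: Kdown Krho _; rewrite fsub1set. Qed.

(** A face of the link avoids the ends by definition of the link, and the
    interior labels because they are fresh.  Hence a union of a new cell and a
    face of the link determines both. *)
Lemma link_label (s : nat) (V : choiceType) (K : {fset {fset V}})
    (g : nat -> V) (tau : {fset V}) (i : nat) :
  is_complex K -> fresh_labels s K g -> tau \in link K (split_edge s g) ->
  (i < s.+2)%N -> g i \notin tau.
Proof.
move=> cK [g_inj g_new] /in_linkP[/fdisjointP dis [_ Ktau]] lti.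
have [-> | i_gt0] := posnP i; first by apply: dis; rewrite !inE eqxx.
move: lti; rewrite ltnS leq_eqVlt => /predU1P[-> | lti].
  by apply: dis; rewrite !inE eqxx orbT.
apply: contra (g_new i _); first exact: complex_mem Ktau.
by rewrite i_gt0.
Qed.

(** The definition of a subdivision removes some faces and puts a family back;
    the part of that family coming from the empty cell and from the two ends of
    the edge consists of faces of [K] that were never removed.  Without it, one
    is left with a disjoint union, indexed without repetition, over which sums
    can be computed. *)
Lemma subdivide_perm (s : nat) (V : choiceType) (K : {fset {fset V}})
    (g : nat -> V) :
  (0 < s)%N -> is_complex K -> fresh_labels s K g ->
  perm_eq (subdivide s K g)
    ([seq rho <- K | ~~ (split_edge s g `<=` rho)] ++
     [seq c `|` tau | c <- new_cells s g, tau <- link K (split_edge s g)]).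
Proof.
move=> s_gt0 cK fg; have [g_inj g_new] := fg; have [K0 Kdown] := cK.
set E := split_edge s g.
have starE rho : rho \in K -> E `<=` rho ->
    exists2 tau, tau \in link K E & rho = E `|` tau.
  move=> Krho Erho; apply/mapP; rewrite -(perm_mem (star_link E cK)).
  by rewrite mem_filter Erho.
have oldE rho : (rho \in K `\` [fset E `|` tau | tau in link K E]) =
    (~~ (E `<=` rho)) && (rho \in K).
  rewrite inE; case: (boolP (rho \in K)) => Krho; rewrite ?andbF ?andbT //.
  congr negb; apply/imfsetP/idP => [[tau /= _ ->] | /(starE _ Krho)[tau]].
    exact: fsubsetUl.
  by exists tau.
have [/eqP | gE] := boolP (g 0%N == g s.+1).
  by move/g_inj; rewrite !inE => /(_ isT (leqnn _)).
apply: uniq_perm => [||rho].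
- exact: fset_uniq.
- rewrite cat_uniq filter_uniq ?fset_uniq //=; apply/andP; split.
    apply/hasPn => _ /allpairsP[[c tau] /= [cN _ ->]].
    have [i lti gic] := new_cell_interior s_gt0 cN.
    rewrite mem_filter negb_and orbC; apply/orP; left.
    apply: contra (g_new i lti) => /(complex_mem cK); apply.
    by rewrite inE gic.
  apply: allpairs_uniq; rewrite ?new_cells_uniq ?fset_uniq //.
  move=> _ y /allpairsP[[c tau] /= [cN lt ->]].
  move=> /allpairsP[[d up] /= [dN lu ->]] /= eq_cd.
  have eqc : c = d.
    apply/fsetP => x; apply/idP/idP => [xc | xd].
      have [i lti xg] := new_cell_label cN xc.
      have : x \in d `|` up by rewrite -eq_cd inE xc.
      by rewrite inE {2}xg (negbTE (link_label cK fg lu lti)) orbF.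
    have [i lti xg] := new_cell_label dN xd.
    have : x \in c `|` tau by rewrite eq_cd inE xd.
    by rewrite inE {2}xg (negbTE (link_label cK fg lt lti)) orbF.
  rewrite -eqc; congr pair; apply/fsetP => x.
  move/fsetP/(_ x): eq_cd; rewrite -eqc !inE; case: (boolP (x \in c)) => //= xc _.
  have [i lti ->] := new_cell_label cN xc.
  by rewrite (negbTE (link_label cK fg lt lti)) (negbTE (link_label cK fg lu lti)).
rewrite mem_cat mem_filter inE oldE; case: (boolP (_ && _)) => //= Nold.
apply/imfset2P/allpairsP; last first.
  move=> [[c tau] /= [cN lt ->]].
  exists c; last by exists tau.
  by rewrite /= path_copyP cN !orbT.
move=> [c /= + [tau /= lt rhoE]].
rewrite rhoE {rho rhoE} in Nold *; rewrite path_copyP => c_copy.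
have [cN | cN] := boolP (c \in new_cells s g); first by exists (c, tau).
(* A cell that is empty or one end of the edge misses the other end [v], so it
   contributes old faces of [K] that do not contain the edge. *)
have [v vE cv] : exists2 v, v \in E & v \notin c /\ c `<=` E.
  have neq : g s.+1 != g 0%N by rewrite eq_sym gE.
  case/or4P: c_copy cN => [/eqP-> _ | /eqP-> _ | /eqP-> _ | -> //].
  - by exists (g 0%N); rewrite /E ?fsub0set !inE ?eqxx.
  - by exists (g s.+1); rewrite /E ?fsub1set !inE ?eqxx ?orbT // neq.
  - by exists (g 0%N); rewrite /E ?fsub1set !inE ?eqxx ?orbT // gE.
move/in_linkP: (lt) => [/fdisjointP dis [KEtau _]].
case/negP: Nold; apply/andP; split.
  apply/negP => /fsubsetP sub; have := sub v vE.
  rewrite in_fsetU (negbTE cv.1) /=.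
  by rewrite (negbTE (dis v vE)).
by apply: Kdown KEtau _; apply: fsetSU; apply: cv.2.
Qed.

(** * Link polynomials *)

(** The f-polynomial of the link of [sigma], written as a sum over the faces
    containing [sigma]; for the empty face it is the f-polynomial of [K]. *)
Definition linkpoly (R : nzRingType) (t : R) (V : choiceType)
    (K : {fset {fset V}}) (sigma : {fset V}) : R :=
  \sum_(rho <- K | sigma `<=` rho) t ^+ (#|` rho| - #|` sigma|).

Lemma linkpoly_link (R : nzRingType) (t : R) (V : choiceType)
    (K : {fset {fset V}}) (sigma : {fset V}) :
  is_complex K ->
  linkpoly t K sigma = \sum_(tau <- link K sigma) t ^+ #|` tau|.
Proof.
move=> cK; rewrite /linkpoly -big_filter (perm_big _ (star_link sigma cK)).
rewrite big_map /=.
apply: eq_big_seq => tau /in_linkP[dis _].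
by rewrite cardfsU (disjoint_fsetI0 dis) cardfs0 subn0 addKn.
Qed.

Lemma subdivide_sum (R : nzRingType) (s : nat) (V : choiceType)
    (K : {fset {fset V}}) (g : nat -> V) (phi : {fset V} -> R) :
  (0 < s)%N -> is_complex K -> fresh_labels s K g ->
  \sum_(rho <- subdivide s K g) phi rho =
  \sum_(rho <- K | ~~ (split_edge s g `<=` rho)) phi rho +
  \sum_(c <- new_cells s g) \sum_(tau <- link K (split_edge s g))
     phi (c `|` tau).
Proof.
move=> s_gt0 cK fg; rewrite (perm_big _ (subdivide_perm s_gt0 cK fg)) /=.
by rewrite big_cat big_filter big_allpairs_dep.
Qed.

Lemma big_new_cells (R : nmodType) (s : nat) (V : choiceType) (g : nat -> V)
    (F : {fset V} -> R) :
  \sum_(c <- new_cells s g) F c =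
  \sum_(0 <= i < s) F [fset g i.+1] + \sum_(0 <= i < s.+1) F [fset g i; g i.+1].
Proof. by rewrite big_cat !big_map /index_iota !subn0. Qed.

Lemma new_cell_link_disjoint (s : nat) (V : choiceType) (K : {fset {fset V}})
    (g : nat -> V) (c tau : {fset V}) :
  is_complex K -> fresh_labels s K g -> c \in new_cells s g ->
  tau \in link K (split_edge s g) -> [disjoint c & tau].
Proof.
move=> cK fg cN lt; apply/fdisjointP => x /(new_cell_label cN)[i lti ->].
exact: link_label lt lti.
Qed.

(** With the lost faces on the left and the gained ones on the right, both sides
    are sums of powers of [t], which the cases below compare term by term. *)
Lemma linkpoly_subdivide (R : nzRingType) (t : R) (s : nat) (V : choiceType)
    (K : {fset {fset V}}) (g : nat -> V) (sigma : {fset V}) :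
  (0 < s)%N -> is_complex K -> fresh_labels s K g ->
  linkpoly t (subdivide s K g) sigma +
    \sum_(tau <- link K (split_edge s g) | sigma `<=` split_edge s g `|` tau)
       t ^+ (2 + #|` tau| - #|` sigma|) =
  linkpoly t K sigma +
    \sum_(c <- new_cells s g)
      \sum_(tau <- link K (split_edge s g) | sigma `<=` c `|` tau)
         t ^+ (#|` c| + #|` tau| - #|` sigma|).
Proof.
move=> s_gt0 cK fg; rewrite /linkpoly.
rewrite big_mkcond (subdivide_sum _ s_gt0 cK fg) /=.
rewrite addrAC; congr (_ + _).
  rewrite [RHS]big_mkcond.
  rewrite [RHS](bigID (fun rho => split_edge s g `<=` rho)) /= addrC.
  congr (_ + _); rewrite -[RHS]big_filter [RHS](perm_big _ (star_link _ cK)).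
  rewrite big_map -big_mkcond /=.
  rewrite big_seq_cond [RHS]big_seq_cond.
  apply: eq_bigr => tau /andP[/in_linkP[dis _] _].
  rewrite cardfsU (disjoint_fsetI0 dis) cardfs0 subn0 cardfs2.
  case: eqP => // /(proj1 fg); rewrite !inE => /(_ isT (leqnn _)) //.
apply: eq_big_seq => c cN; rewrite -big_mkcond /=.
rewrite big_seq_cond [RHS]big_seq_cond; apply: eq_bigr => tau /andP[lt _].
have dis := new_cell_link_disjoint cK fg cN lt.
by rewrite cardfsU (disjoint_fsetI0 dis) cardfs0 subn0.
Qed.

Lemma card_new_edge (s : nat) (V : choiceType) (g : nat -> V) (i : nat) :
  {in [pred i | (i <= s.+1)%N] &, injective g} -> (i < s.+1)%N ->
  #|` [fset g i; g i.+1]| = 2%N.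
Proof.
move=> g_inj lti; rewrite cardfs2; case: eqP => // /g_inj; rewrite !inE => eq_i.
by have := eq_i ltac:(lia) ltac:(lia); lia.
Qed.

(** The path has [s] interior vertices and [s.+1] edges, and replaces one edge:
    the gain per face of the link is s t + (s + 1) t ^ 2 - t ^ 2. *)
Lemma facepoly_subdivide (R : comNzRingType) (t : R) (s : nat) (V : choiceType)
    (K : {fset {fset V}}) (g : nat -> V) :
  (0 < s)%N -> is_complex K -> fresh_labels s K g ->
  linkpoly t (subdivide s K g) fset0 =
  linkpoly t K fset0 + s%:R * (t * (1 + t)) * linkpoly t K (split_edge s g).
Proof.
move=> s_gt0 cK fg; have := linkpoly_subdivide t fset0 s_gt0 cK fg.
rewrite (linkpoly_link _ (split_edge s g) cK).
set S := \sum_(tau <- link K _) t ^+ #|` tau|.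
under eq_bigl do rewrite fsub0set.
under eq_bigr do rewrite cardfs0 subn0 exprD.
rewrite -mulr_sumr -/S.
under [X in _ = _ + X -> _]eq_bigr => c _.
  under eq_bigl do rewrite fsub0set.
  under eq_bigr do rewrite cardfs0 subn0 exprD.
  rewrite -mulr_sumr -/S.
  over.
rewrite -mulr_suml big_new_cells.
under eq_bigr do rewrite cardfs1 expr1.
rewrite [X in (_ + X) * S](eq_big_nat _ _ (F2 := fun=> t ^+ 2)) => [|i lti].
  rewrite !sumr_const_nat !subn0 => /eqP; rewrite -subr_eq addrC => /eqP <-.
  by rewrite -mulr_natl -[t ^+ 2 *+ _]mulr_natl -natr1; ring.
by rewrite (card_new_edge (proj1 fg)).
Qed.

(** If [sigma] and the edge span no face, then no removed face contains
    [sigma], and neither does an added one, since its old vertices lie in a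
    removed face. *)
Lemma linkpoly_subdivide_far (R : nzRingType) (t : R) (s : nat)
    (V : choiceType) (K : {fset {fset V}}) (g : nat -> V) (sigma : {fset V}) :
  (0 < s)%N -> is_complex K -> fresh_labels s K g ->
  (forall i, (0 < i < s.+1)%N -> g i \notin sigma) ->
  sigma `|` split_edge s g \notin K ->
  linkpoly t (subdivide s K g) sigma = linkpoly t K sigma.
Proof.
move=> s_gt0 cK fg sg sE; have := linkpoly_subdivide t sigma s_gt0 cK fg.
have main tau : tau \in link K (split_edge s g) ->
    ~~ (sigma `<=` split_edge s g `|` tau).
  move=> /in_linkP[_ [KE _]]; apply: contra sE => sub.
  by apply: cK.2 KE _; rewrite fsubUset sub fsubsetUl.
rewrite big_seq_cond big_pred0 => [|tau]; last first.
  by case: (boolP (tau \in _)) => //= /main/negbTE.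
rewrite [X in _ = _ + X -> _]big_seq_cond big1 ?addr0 // => c /andP[cN _].
rewrite big_seq_cond big_pred0 // => tau.
case: (boolP (tau \in _)) => //= /main; apply: contraNF => /fsubsetP sub.
apply/fsubsetP => x xs; have := sub x xs; rewrite !inE.
case/orP => [xc | ->]; last by rewrite orbT.
have [i lti xg] := new_cell_label cN xc.
case: i lti xg => [|i] lti xg; first by rewrite xg eqxx.
move: lti; rewrite !ltnS leq_eqVlt => /predU1P[is_end | lti].
  by rewrite xg is_end eqxx orbT.
by move: (sg i.+1 lti); rewrite -xg xs.
Qed.

(** In the link of an end [v] of the edge, the other end is renamed to the
    neighbour of [v] on the path: only one new cell contains [v], and it has as
    many vertices as the edge. *)
Lemma linkpoly_subdivide_end (R : nzRingType) (t : R) (s : nat)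
    (V : choiceType) (K : {fset {fset V}}) (g : nat -> V) (v : V) :
  (0 < s)%N -> is_complex K -> fresh_labels s K g -> v \in split_edge s g ->
  linkpoly t (subdivide s K g) [fset v] = linkpoly t K [fset v].
Proof.
move=> s_gt0 cK fg vE; have := linkpoly_subdivide t [fset v] s_gt0 cK fg.
have gI i j : (i <= s.+1)%N -> (j <= s.+1)%N -> (g i == g j) = (i == j).
  move=> lti ltj; apply/eqP/eqP => [|-> //]; exact: (proj1 fg).
have [m lem vm] : exists2 m, (m <= s.+1)%N & v = g m.
  by move: vE; rewrite !inE => /orP[] /eqP->; [exists 0%N | exists s.+1].
(* [g k] and [g k.+1] span the only edge of the path at [v]. *)
have [k ltk kE] : exists2 k, (k < s.+1)%N &
    forall i, (i < s.+1)%N -> ((m == i) || (m == i.+1)) = (i == k).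
  move: vE; rewrite vm !inE !gI // => /orP[] /eqP->.
    by exists 0%N => // i lti; lia.
  by exists s => // i lti; lia.
have m_end i : (i < s)%N -> (m == i.+1) = false.
  by move: vE; rewrite vm !inE !gI // => /orP[] /eqP->; lia.
have linkE c tau : tau \in link K (split_edge s g) ->
    ([fset v] `<=` c `|` tau) = (v \in c).
  move=> lt; rewrite fsub1set inE vm (negbTE (link_label cK fg lt _)) ?orbF //.
have linkS c : \sum_(tau <- link K (split_edge s g) | [fset v] `<=` c `|` tau)
     t ^+ (#|` c| + #|` tau| - #|` [fset v]|) =
    if v \in c then \sum_(tau <- link K (split_edge s g))
      t ^+ (#|` c| + #|` tau| - #|` [fset v]|) else 0.
  rewrite big_seq_cond; case: ifP => vc.
    rewrite [RHS]big_seq_cond; apply: eq_bigl => tau; rewrite andbT.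
    by case: (boolP (tau \in _)) => //= lt; rewrite linkE.
  rewrite big_pred0 // => tau.
  by case: (boolP (tau \in _)) => //= lt; rewrite linkE.
have cE : #|` split_edge s g| = 2%N by rewrite cardfs2 gI.
rewrite -{1}cE linkS vE.
under [X in _ = _ + X -> _]eq_bigr do rewrite linkS.
suff -> : \sum_(c <- new_cells s g)
    (if v \in c then \sum_(tau <- link K (split_edge s g))
       t ^+ (#|` c| + #|` tau| - #|` [fset v]|) else 0) =
  \sum_(tau <- link K (split_edge s g))
     t ^+ (#|` split_edge s g| + #|` tau| - #|` [fset v]|).
  exact: addIr.
rewrite big_new_cells big_nat big1 ?add0r => [|i /andP[_ lti]]; last first.
  by rewrite inE vm gI ?m_end //; lia.
rewrite (bigD1_seq k) ?mem_index_iota ?iota_uniq //=.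
rewrite !inE vm !gI ?(ltnW ltk) // kE // eqxx -vm.
rewrite [X in _ + X]big_nat_cond.
rewrite [X in _ + X]big1 ?addr0 => [|i /andP[/andP[_ lti] ik]]; last first.
  by rewrite !inE vm !gI ?(ltnW lti) // kE // (negbTE ik).
by rewrite cE (card_new_edge (proj1 fg)).
Qed.

(** * Vertices and closure of a subdivision *)

Lemma subdivideP (s : nat) (V : choiceType) (K : {fset {fset V}})
    (g : nat -> V) (rho : {fset V}) :
  (0 < s)%N -> is_complex K -> fresh_labels s K g ->
  reflect ((rho \in K /\ ~~ (split_edge s g `<=` rho)) \/
           exists c tau, [/\ c \in new_cells s g,
                          tau \in link K (split_edge s g) & rho = c `|` tau])
          (rho \in subdivide s K g).
Proof.
move=> s_gt0 cK fg; rewrite (perm_mem (subdivide_perm s_gt0 cK fg)).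
rewrite mem_cat mem_filter.
apply: (iffP orP) => -[].
- by case/andP; left.
- by case/allpairsP => -[c tau] /= [cN lt ->]; right; exists c, tau.
- by case=> -> ->; left.
- by move=> [c [tau [cN lt ->]]]; right; apply/allpairsP; exists (c, tau).
Qed.

Lemma subdivide_old (s : nat) (V : choiceType) (K : {fset {fset V}})
    (g : nat -> V) (rho : {fset V}) :
  (0 < s)%N -> is_complex K -> fresh_labels s K g ->
  (forall i, (0 < i < s.+1)%N -> g i \notin rho) ->
  rho \in subdivide s K g -> rho \in K /\ ~~ (split_edge s g `<=` rho).
Proof.
move=> s_gt0 cK fg rho_old /(subdivideP _ s_gt0 cK fg)[//|[c [tau [cN _ rhoE]]]].
have [i lti gic] := new_cell_interior s_gt0 cN.
by have := rho_old i lti; rewrite rhoE in_fsetU gic.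
Qed.

Lemma subdivide_vertex (s : nat) (V : choiceType) (K : {fset {fset V}})
    (g : nat -> V) (x : V) :
  (0 < s)%N -> is_complex K -> fresh_labels s K g ->
  [fset x] \in subdivide s K g ->
  [fset x] \in K \/ exists2 i, (0 < i < s.+1)%N & x = g i.
Proof.
move=> s_gt0 cK fg /(subdivideP _ s_gt0 cK fg)[[]|]; first by left.
move=> [c [tau [cN _ /fsetP xE]]]; right.
have [i lti gic] := new_cell_interior s_gt0 cN; exists i => //.
by have := xE (g i); rewrite in_fsetU gic in_fset1 => /eqP.
Qed.

Lemma path_copy_down (s : nat) (V : choiceType) (g : nat -> V)
    (c d : {fset V}) :
  c \in path_copy s g -> d `<=` c -> d \in path_copy s g.
Proof.
case/imfsetP => rho /= rhoP -> /fsubsetP dc.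
pose rho' := [fset i in rho | g i \in d].
have -> : d = [fset g i | i in rho'].
  apply/fsetP => x; apply/idP/imfsetP => [xd | [i /=]]; last first.
    by rewrite !inE => /andP[_ gid] ->.
  have /imfsetP[i /= irho xg] := dc x xd; exists i => //=.
  by rewrite !inE irho -xg.
apply/imfsetP; exists rho' => //=.
have : rho' `<=` rho by apply: fset_sub.
case/path_complexP: rhoP => [-> | [i lti ->] | [i lti ->]].
- by rewrite fsubset0 => /eqP->; apply/path_complexP; constructor 1.
- rewrite fsubset1 => /orP[] /eqP->; apply/path_complexP; last by constructor 1.
  by constructor 2; exists i.
- rewrite -[[fset _; _]]/(i |` [fset i.+1]) -fsubDset fsubset1.
  have [ir | ir] := boolP (i \in rho'); last first.
    rewrite mem_fsetD1 // => /orP[] /eqP->; apply/path_complexP.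
      by constructor 2; exists i.+1.
    by constructor 1.
  move=> sub; rewrite -(fsetD1K ir); case/orP: sub => /eqP->; apply/path_complexP.
    by constructor 3; exists i.
  by constructor 2; exists i; rewrite ?fsetU0 // ltnW.
Qed.

Lemma link_down (V : choiceType) (K : {fset {fset V}})
    (sigma tau up : {fset V}) :
  is_complex K -> tau \in link K sigma -> up `<=` tau -> up \in link K sigma.
Proof.
move=> [_ Kdown] /in_linkP[dis [KU Kt]] sub; apply/in_linkP; split; last split.
- exact: fdisjointWr sub dis.
- by apply: Kdown KU _; apply: fsetUS.
- exact: Kdown Kt sub.
Qed.

Lemma subdivide_complex (s : nat) (V : choiceType) (K : {fset {fset V}})
    (g : nat -> V) :
  (0 < s)%N -> is_complex K -> fresh_labels s K g ->
  is_complex (subdivide s K g).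
Proof.
move=> s_gt0 cK fg; split.
  by apply/(subdivideP _ s_gt0 cK fg); left; split; rewrite ?cK.1 // fsubset0;
     apply/fset0Pn; exists (g 0%N); rewrite !inE eqxx.
move=> rho rho' /(subdivideP _ s_gt0 cK fg)[[Krho Erho] sub|].
  apply/(subdivideP _ s_gt0 cK fg); left; split; first exact: cK.2 Krho sub.
  by apply: contra Erho => /fsubset_trans; apply.
move=> [c [tau [cN lt ->]]] sub; rewrite inE; apply/orP; right.
apply/imfset2P; exists (rho' `&` c) => /=.
  by apply: path_copy_down (fsubsetIr _ _); rewrite path_copyP cN !orbT.
exists (rho' `&` tau) => /=; first exact: link_down lt (fsubsetIr _ _).
by rewrite -fsetIUr; apply/esym/fsetIidPl.
Qed.

(** * Cones *)

Definition cone (V : choiceType) (a : V) (K : {fset {fset V}}) :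
    {fset {fset V}} :=
  K `|` [fset a |` rho | rho in K].

(** Membership in a cone depends only on the face without its apex; this is
    what makes links and subdivisions commute with cones. *)
Lemma in_cone (V : choiceType) (a : V) (K : {fset {fset V}})
    (rho : {fset V}) :
  is_complex K -> [fset a] \notin K -> (rho \in cone a K) = (rho `\ a \in K).
Proof.
move=> cK aK.
have Ka tau : tau \in K -> a \notin tau.
  by move=> Kt; apply: contra aK; apply: complex_mem Kt.
rewrite inE; apply/orP/idP => [[Kr | /imfsetP[tau /= Kt ->]] | Kr].
- by rewrite mem_fsetD1 ?Ka.
- by rewrite fsetU1K ?Ka.
have [ar | ar] := boolP (a \in rho); last by left; rewrite -(mem_fsetD1 ar).
by right; apply/imfsetP; exists (rho `\ a); rewrite ?fsetD1K.
Qed.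

Lemma cone_complex (V : choiceType) (a : V) (K : {fset {fset V}}) :
  is_complex K -> [fset a] \notin K -> is_complex (cone a K).
Proof.
move=> cK aK; split=> [|rho tau]; first by rewrite inE cK.1.
by rewrite !in_cone // => Kr sub; apply: cK.2 Kr _; apply: fsetSD.
Qed.

Lemma cone_vertex (V : choiceType) (a : V) (K : {fset {fset V}}) (x : V) :
  is_complex K -> [fset a] \notin K ->
  ([fset x] \in cone a K) = (x == a) || ([fset x] \in K).
Proof.
move=> cK aK; rewrite in_cone //; case: eqVneq => [-> | xa].
  by rewrite fsetDv cK.1.
by rewrite mem_fsetD1 // inE eq_sym.
Qed.

Lemma cone_perm (V : choiceType) (a : V) (K : {fset {fset V}}) :
  is_complex K -> [fset a] \notin K ->
  perm_eq (cone a K) (K ++ [seq a |` rho | rho <- K]).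
Proof.
move=> cK aK.
have Ka tau : tau \in K -> a \notin tau.
  by move=> Kt; apply: contra aK; apply: complex_mem Kt.
apply: uniq_perm => [||rho]; first exact: fset_uniq.
  rewrite cat_uniq fset_uniq /=; apply/andP; split.
    by apply/hasPn => _ /mapP[tau _ ->]; apply/negP => /Ka; rewrite fset1U1.
  rewrite map_inj_in_uniq ?fset_uniq // => x y Kx Ky /(congr1 (fun r => r `\ a)).
  by rewrite !fsetU1K ?Ka.
rewrite mem_cat inE; congr (_ || _).
by apply/imfsetP/mapP => -[tau /= Kt ->]; exists tau.
Qed.

Lemma linkpoly_cone (R : nzRingType) (t : R) (V : choiceType) (a : V)
    (K : {fset {fset V}}) (sigma : {fset V}) :
  is_complex K -> [fset a] \notin K -> a \notin sigma ->
  linkpoly t (cone a K) sigma = (1 + t) * linkpoly t K sigma.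
Proof.
move=> cK aK asig.
rewrite /linkpoly (perm_big _ (cone_perm cK aK)) big_cat big_map /= mulrDl mul1r.
congr (_ + _); rewrite mulr_sumr big_seq_cond [RHS]big_seq_cond.
apply: eq_big => [rho | rho /andP[Kr sub]].
  by rewrite -fsubDset mem_fsetD1.
have ar : a \notin rho by apply: contra aK; apply: complex_mem Kr.
rewrite -exprS cardfsU1 ar add1n subSn //; apply: fsubset_leq_card.
by move: sub; rewrite -fsubDset mem_fsetD1.
Qed.

Lemma linkpoly_cone_apex (R : nzRingType) (t : R) (V : choiceType) (a : V)
    (K : {fset {fset V}}) (sigma : {fset V}) :
  is_complex K -> [fset a] \notin K -> a \notin sigma ->
  linkpoly t (cone a K) (a |` sigma) = linkpoly t K sigma.
Proof.
move=> cK aK asig.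
have Ka rho : rho \in K -> a \notin rho.
  by move=> Kr; apply: contra aK; apply: complex_mem Kr.
rewrite /linkpoly (perm_big _ (cone_perm cK aK)) big_cat big_map /=.
rewrite big_seq_cond big_pred0 => [|rho]; last first.
  by apply/negP => /andP[/Ka]; rewrite fsubUset fsub1set => /negbTE->.
rewrite add0r big_seq_cond [RHS]big_seq_cond.
apply: eq_big => [rho | rho /andP[/Ka ar _]].
  case: (boolP (rho \in K)) => //= /Ka ar.
  by rewrite fsubUset fsub1set fset1U1 /= -fsubDset mem_fsetD1.
by rewrite !cardfsU1 ar asig.
Qed.

Lemma link_cone (V : choiceType) (a : V) (K : {fset {fset V}})
    (sigma tau : {fset V}) :
  is_complex K -> [fset a] \notin K -> a \notin sigma ->
  (tau \in link (cone a K) sigma) = (tau `\ a \in link K sigma).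
Proof.
move=> cK aK asig; apply/in_linkP/in_linkP; rewrite !in_cone // => -[dis [KU Kt]].
  split; first exact: fdisjointWr (fsubD1set _ _) dis.
  split=> //; move: KU; rewrite fsetDUl [sigma `\ a]mem_fsetD1 //.
split; last first.
  by split=> //; move: KU; rewrite fsetDUl [sigma `\ a]mem_fsetD1 //.
apply/fdisjointP => x xs; apply/negP => xt.
move/fdisjointP: dis => /(_ x xs); rewrite !inE xt andbT negbK => /eqP xa.
by rewrite -xa xs in asig.
Qed.

Lemma fresh_labels_cone (s : nat) (V : choiceType) (a : V)
    (K : {fset {fset V}}) (g : nat -> V) :
  is_complex K -> [fset a] \notin K ->
  (forall i, (i <= s.+1)%N -> g i != a) ->
  fresh_labels s K g -> fresh_labels s (cone a K) g.
Proof.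
move=> cK aK ga [g_inj g_new]; split=> // i lti.
by rewrite cone_vertex // negb_or g_new // ga //; lia.
Qed.

(** If the apex [a] is not a vertex of the path, then adding [a] to a face or
    removing it from a face changes neither whether the face contains the edge
    nor its trace on the path. *)
Lemma cone_subdivide (s : nat) (V : choiceType) (a : V)
    (K : {fset {fset V}}) (g : nat -> V) :
  (0 < s)%N -> is_complex K -> [fset a] \notin K ->
  (forall i, (i <= s.+1)%N -> g i != a) -> fresh_labels s K g ->
  cone a (subdivide s K g) = subdivide s (cone a K) g.
Proof.
move=> s_gt0 cK aK ga fg.
have aS : [fset a] \notin subdivide s K g.
  apply/negP => /(subdivide_vertex s_gt0 cK fg)[|[i lti aE]].
    by rewrite (negbTE aK).
  by have := ga i ltac:(lia); rewrite -aE eqxx.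
have cC := cone_complex cK aK; have fgC := fresh_labels_cone cK aK ga fg.
have aE : a \notin split_edge s g by rewrite !inE negb_or ![a == _]eq_sym !ga.
have ac c : c \in new_cells s g -> a \notin c.
  move=> cN; apply/negP => /(new_cell_label cN)[i lti ai].
  by have := ga i lti; rewrite -ai eqxx.
apply/fsetP => rho; rewrite in_cone //; last exact: subdivide_complex.
apply/(subdivideP _ s_gt0 cK fg)/(subdivideP _ s_gt0 cC fgC).
  rewrite in_cone // fsubsetD1 aE andbT; case; first by left.
  (* Replace [tau] by the rest of [rho], which may contain the apex. *)
  move=> [c [tau [cN lt rE]]]; right; exists c, (rho `\` c).
  have atau : a \notin tau.
    by move/in_linkP: lt => [_ [_ Kt]]; apply: contra aK; apply: complex_mem Kt.
  have dis := new_cell_link_disjoint cK fg cN lt.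
  have sub : c `<=` rho.
    by apply: fsubset_trans (fsubD1set rho a); rewrite rE fsubsetUl.
  split=> //; last by rewrite fsetUDl fsetDv fsetD0; apply/esym/fsetUidPr.
  rewrite link_cone // fsetDDl fsetUC -fsetDDl rE fsetDUl fsetDv fset0U.
  by move: dis; rewrite fdisjoint_sym => /fsetDidPl->.
rewrite in_cone //; case=> [[Kr Er] | ].
  by left; split=> //; rewrite fsubsetD1 aE andbT.
move=> [c [tau [cN + ->]]]; rewrite link_cone // => lt; right; exists c, (tau `\ a).
by split=> //; rewrite fsetDUl mem_fsetD1 // ac.
Qed.

(** * Successive subdivisions *)

(** Freshness of the labels of a path refers to the complex reached when the
    turn of its edge comes, where earlier labels are already vertices. *)
Fixpoint fresh_tower (s : nat) (V : choiceType) (I : eqType) (lab : I -> nat -> V)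
    (K : {fset {fset V}}) (es : seq I) : Prop :=
  if es is e :: es' then
    fresh_labels s K (lab e) /\ fresh_tower s lab (subdivide s K (lab e)) es'
  else True.

Definition subdivide_all (s : nat) (V : choiceType) (I : eqType)
    (lab : I -> nat -> V) (K : {fset {fset V}}) (es : seq I) :
    {fset {fset V}} :=
  foldl (fun K e => subdivide s K (lab e)) K es.

Lemma tower_cat (s : nat) (V : choiceType) (I : eqType) (lab : I -> nat -> V)
    (K : {fset {fset V}}) (es fs : seq I) :
  fresh_tower s lab K (es ++ fs) <->
  fresh_tower s lab K es /\ fresh_tower s lab (subdivide_all s lab K es) fs.
Proof. by elim: es K => [|e es IH] K /=; [tauto | rewrite IH; tauto]. Qed.

Lemma tower_complex (s : nat) (V : choiceType) (I : eqType)
    (lab : I -> nat -> V) (K : {fset {fset V}}) (es : seq I) :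
  (0 < s)%N -> is_complex K -> fresh_tower s lab K es ->
  is_complex (subdivide_all s lab K es).
Proof.
move=> s_gt0; elim: es K => [|e es IH] K //= cK [fg tw].
by apply: IH tw; apply: subdivide_complex.
Qed.

Lemma tower_cone (s : nat) (V : choiceType) (I : eqType) (lab : I -> nat -> V)
    (a : V) (K : {fset {fset V}}) (es : seq I) :
  (0 < s)%N -> is_complex K -> [fset a] \notin K ->
  (forall e i, e \in es -> (i <= s.+1)%N -> lab e i != a) ->
  fresh_tower s lab K es ->
  fresh_tower s lab (cone a K) es /\
  subdivide_all s lab (cone a K) es = cone a (subdivide_all s lab K es).
Proof.
move=> s_gt0; elim: es K => [|e es IH] K //= cK aK la [fg tw].
have ga i : (i <= s.+1)%N -> lab e i != a by apply: la; rewrite inE eqxx.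
rewrite -cone_subdivide //.
have aS : [fset a] \notin subdivide s K (lab e).
  apply/negP => /(subdivide_vertex s_gt0 cK fg)[|[i lti aE]].
    by rewrite (negbTE aK).
  by have := ga i ltac:(lia); rewrite -aE eqxx.
have la' f i : f \in es -> (i <= s.+1)%N -> lab f i != a.
  by move=> fes; apply: la; rewrite inE fes orbT.
have [tw' ->] := IH _ (subdivide_complex s_gt0 cK fg) aS la' tw.
by split=> //; split=> //; apply: fresh_labels_cone.
Qed.

Lemma tower_triangulation (s : nat) (V : choiceType) (I : eqType)
    (lab : I -> nat -> V) (K : {fset {fset V}}) (es : seq I) :
  (0 < s)%N -> is_complex K -> fresh_tower s lab K es ->
  uniq [seq split_edge s (lab e) | e <- es] ->
  [seq split_edge s (lab e) | e <- es] =i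
    [fset sigma in K | #|` sigma| == 2%N] ->
  tchebyshev_triangulation s K (subdivide_all s lab K es).
Proof.
move=> s_gt0 cK tw es_uniq es_edges.
exists [seq split_edge s (lab e) | e <- es].
exists (fun i => subdivide_all s lab K (take i es)).
have tw_take i : fresh_tower s lab K (take i es).
  by move: tw; rewrite -{1}(cat_take_drop i es) tower_cat => -[].
rewrite size_map; split=> // [|i _|i lti].
- by rewrite take0 take_size.
- exact: tower_complex.
have [e0 _] : exists e0 : I, True.
  by case: es lti {tw es_uniq es_edges tw_take} => // e; exists e.
rewrite (nth_map e0) // (take_nth e0) //.
have := tw_take i.+1; rewrite (take_nth e0) // -cats1 tower_cat.
move=> -[_ [[g_inj g_new] _]].
exists (lab (nth e0 es i)); split=> //.
by rewrite /subdivide_all foldl_cat.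
Qed.

(** * Triangulated simplices *)

(** The vertex [orig i] is the i-th vertex of the simplex, and [(i, j, k)] with
    0 < k is the k-th interior vertex of the path replacing the edge between
    [orig i] and [orig j].  With such names all labels are fresh in advance, and
    the apex of the next cone is new as well. *)
Definition vertex : Type := (nat * nat * nat)%type.

Definition orig (i : nat) : vertex := (i, i, 0%N).

Definition edge_label (s : nat) (e : nat * nat) (k : nat) : vertex :=
  if k == 0%N then orig e.1 else
  if k == s.+1 then orig e.2 else (e.1, e.2, k).

Fixpoint simplex (n : nat) : {fset {fset vertex}} :=
  if n is m.+1 then cone (orig m) (simplex m) else [fset fset0].

Fixpoint simplex_edges (n : nat) : seq (nat * nat) :=
  if n is m.+1 then simplex_edges m ++ [seq (i, m) | i <- iota 0 m] else [::].

Definition simplex_tri (s n : nat) : {fset {fset vertex}} :=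
  subdivide_all s (edge_label s) (simplex n) (simplex_edges n).

(** Interpolates between the cone over the triangulated simplex, at m = 0, and
    the next triangulated simplex, at m = n. *)
Definition cone_tri (s n m : nat) : {fset {fset vertex}} :=
  subdivide_all s (edge_label s) (cone (orig n) (simplex_tri s n))
    [seq (i, n) | i <- iota 0 m].

Lemma orig_inj : injective orig.
Proof. by move=> i j []. Qed.

Lemma split_edge_label (s : nat) (e : nat * nat) :
  split_edge s (edge_label s e) = [fset orig e.1; orig e.2].
Proof. by rewrite /split_edge /edge_label !eqxx. Qed.

Lemma edge_label_interior (s : nat) (e : nat * nat) (k : nat) :
  (0 < k < s.+1)%N -> edge_label s e k = (e.1, e.2, k).
Proof. by move=> ltk; rewrite /edge_label !ifN //; lia. Qed.

Lemma edge_label_inj (s : nat) (e : nat * nat) :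
  e.1 != e.2 -> {in [pred i | (i <= s.+1)%N] &, injective (edge_label s e)}.
Proof.
move=> ne k l; rewrite !inE /edge_label => lek lel.
by do ?case: eqP => ?; move=> labE; first [lia | case: labE; lia].
Qed.

Lemma mem_simplex_edges (n : nat) (e : nat * nat) :
  (e \in simplex_edges n) = (e.1 < e.2 < n)%N.
Proof.
case: e => i j; elim: n => [|n IH] /=; first by rewrite in_nil ltn0 andbF.
rewrite mem_cat IH /=.
have -> : ((i, j) \in [seq (k, n) | k <- iota 0 n]) = (i < n)%N && (j == n).
  apply/mapP/andP => [[k + [-> ->]] | [lti /eqP->]].
    by rewrite mem_iota eqxx.
  by exists i; rewrite // mem_iota.
lia.
Qed.

(** Both parts are proved together because the description of the faces of a
    cone requires a complex. *)
Lemma simplex_faces (n : nat) :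
  is_complex (simplex n) /\
  forall rho, rho \in simplex n <->
              (forall x, x \in rho -> exists2 i, (i < n)%N & x = orig i).
Proof.
elim: n => [|n [cS IH]] /=.
  split=> [|rho]; first split=> [|rho tau].
  - by rewrite inE.
  - by rewrite !inE => /eqP->; rewrite fsubset0.
  rewrite inE; split=> [/eqP-> // | rho0].
  by rewrite -fsubset0; apply/fsubsetP => x /rho0[].
have aS : [fset orig n] \notin simplex n.
  apply/negP => /IH/(_ (orig n)); rewrite inE eqxx.
move=> /(_ isT)[i lti /orig_inj ni].
  by rewrite ni ltnn in lti.
split=> [|rho]; first exact: cone_complex.
rewrite in_cone // IH; split=> rhoP x.
  have [-> _ | xn xr] := eqVneq x (orig n); first by exists n.
  by have [|i lti ->] := rhoP x; [rewrite !inE xn | exists i; rewrite // ltnW].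
rewrite !inE => /andP[xn xr]; have [i lti xE] := rhoP x xr; exists i => //.
by move: lti; rewrite ltnS leq_eqVlt => /predU1P[iE | //]; rewrite xE iE eqxx in xn.
Qed.

Lemma simplex_complex (n : nat) : is_complex (simplex n).
Proof. by case: (simplex_faces n). Qed.

Lemma simplexP (n : nat) (rho : {fset vertex}) :
  reflect (forall x, x \in rho -> exists2 i, (i < n)%N & x = orig i)
          (rho \in simplex n).
Proof. by have [_ facesE] := simplex_faces n; apply: (iffP idP) => /facesE. Qed.

Lemma simplex_apex (n : nat) : [fset orig n] \notin simplex n.
Proof.
apply/negP => /simplexP/(_ (orig n)); rewrite inE eqxx.
move=> /(_ isT)[i lti /orig_inj ni].
by rewrite ni ltnn in lti.
Qed.

Lemma simplex_edges_uniq (s n : nat) :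
  uniq [seq split_edge s (edge_label s e) | e <- simplex_edges n].
Proof.
rewrite map_inj_in_uniq.
  elim: n => //= n IH; rewrite cat_uniq IH /= map_inj_uniq ?iota_uniq ?andbT.
    apply/hasPn => _ /mapP[i _ ->]; rewrite mem_simplex_edges /=; lia.
  by move=> i j [].
move=> [i j] [k l]; rewrite !mem_simplex_edges !split_edge_label /=.
move=> lij lkl /fsetP eqE.
have in2 x y a : (orig a \in [fset orig x; orig y]) = (a == x) || (a == y).
  by rewrite !inE !(inj_eq orig_inj).
have := eqE (orig i); have := eqE (orig j).
have := eqE (orig k); have := eqE (orig l).
rewrite !in2 !eqxx /= ?orbT => ? ? ? ?; congr pair; lia.
Qed.

Lemma simplex_edges_mem (s n : nat) :
  [seq split_edge s (edge_label s e) | e <- simplex_edges n] =i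
    [fset sigma in simplex n | #|` sigma| == 2%N].
Proof.
move=> sigma; rewrite !inE /=; apply/mapP/andP => [[e + ->] | [/simplexP sP card2]].
  rewrite mem_simplex_edges split_edge_label => /andP[lt12 lt2n]; split.
    apply/simplexP => x; rewrite !inE => /orP[] /eqP->; last by exists e.2.
    by exists e.1; rewrite // (ltn_trans lt12).
  rewrite cardfs2; case: (orig e.1 =P orig e.2) => // /orig_inj eq12.
  by rewrite eq12 ltnn in lt12.
have [x xs] : exists x, x \in sigma.
  by apply/fset0Pn; rewrite -cardfs_gt0 (eqP card2).
move: card2; rewrite (cardfsD1 x) xs => /cardfs1P[y yE].
have sE : sigma = [fset x; y] by rewrite -(fsetD1K xs) yE.
have /sP[j ltj yj] : y \in sigma by rewrite sE !inE eqxx orbT.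
have [i lti xi] := sP x xs.
have : y \in sigma `\ x by rewrite yE inE.
rewrite !inE xi yj (inj_eq orig_inj) => /andP[ne _].
case: (ltngtP i j) ne => // ltij _; [exists (i, j) | exists (j, i)].
- by rewrite mem_simplex_edges ltij.
- by rewrite split_edge_label sE xi yj.
- by rewrite mem_simplex_edges ltij.
- by rewrite split_edge_label sE xi yj fsetUC.
Qed.

Lemma cone_tri0 (s n : nat) : cone_tri s n 0 = cone (orig n) (simplex_tri s n).
Proof. by []. Qed.

Lemma cone_triS (s n m : nat) :
  cone_tri s n m.+1 = subdivide s (cone_tri s n m) (edge_label s (m, n)).
Proof. by rewrite /cone_tri -addn1 iotaD map_cat /subdivide_all foldl_cat. Qed.

(** What the induction on [n] preserves: the labels in use, which make the next
    ones fresh, and the absence of edges between original vertices, which makes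
    subdivisions of edges through the next apex independent. *)
Definition tri_separated (s n : nat) : Prop :=
  [/\ is_complex (simplex_tri s n),
      forall i j k, [fset (i, j, k)] \in simplex_tri s n -> (i < n)%N && (j < n)%N
    & forall i j, (i < j)%N -> [fset orig i; orig j] \notin simplex_tri s n].

(** For m = n this is [tri_separated] at n + 1, which closes the induction. *)
Definition cone_separated (s n m : nat) : Prop :=
  [/\ is_complex (cone_tri s n m),
      forall i j k, [fset (i, j, k)] \in cone_tri s n m ->
         [\/ (i < n)%N && (j < n)%N, (i, j, k) = orig n | (i < m)%N && (j == n)],
      forall i j, (i < j < n)%N -> [fset orig i; orig j] \notin cone_tri s n m
    & forall i, (i < m)%N -> [fset orig i; orig n] \notin cone_tri s n m].

Lemma tri_apex (s n : nat) : tri_separated s n -> [fset orig n] \notin simplex_tri s n.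
Proof. by case=> _ vP _; apply/negP => /vP; rewrite ltnn. Qed.

Lemma cone_fresh (s n m : nat) :
  cone_separated s n m -> (m < n)%N ->
  fresh_labels s (cone_tri s n m) (edge_label s (m, n)).
Proof.
move=> [_ vP _ _] ltmn; split; first by apply: edge_label_inj => /=; lia.
move=> k ltk; rewrite edge_label_interior //=; apply/negP => /vP[|[]|]; lia.
Qed.

Lemma orig_not_interior (s m n k i : nat) : (0 < k < s.+1)%N ->
  (edge_label s (m, n) k == orig i) = false.
Proof. by move=> ltk; rewrite edge_label_interior //; apply/eqP => -[]; lia. Qed.

Lemma cone_separatedS (s n m : nat) : (0 < s)%N -> (m < n)%N ->
  cone_separated s n m -> cone_separated s n m.+1.
Proof.
move=> s_gt0 ltmn ok; have fg := cone_fresh ok ltmn.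
have [cK vP noe noa] := ok; rewrite /cone_separated cone_triS.
have old i j rho : rho = [fset orig i; orig j] ->
   rho \in subdivide s (cone_tri s n m) (edge_label s (m, n)) ->
   rho \in cone_tri s n m /\ ~~ ([fset orig m; orig n] `<=` rho).
  move=> -> /(subdivide_old s_gt0 cK fg); rewrite split_edge_label; apply=> k ltk.
  by rewrite !inE !orig_not_interior.
split.
- exact: subdivide_complex.
- move=> i j k /(subdivide_vertex s_gt0 cK fg)[/vP[]|].
  + by constructor 1.
  + by constructor 2.
  + by constructor 3; lia.
  case=> l ltl; rewrite edge_label_interior // => -[-> -> _].
  by constructor 3; rewrite /= ltnSn eqxx.
- move=> i j lij; apply/negP => /(old _ _ _ erefl)[].
  by rewrite (negbTE (noe _ _ lij)).
- move=> i; rewrite ltnS leq_eqVlt => /predU1P[-> | lti].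
  all: apply/negP => /(old _ _ _ erefl)[].
    by rewrite fsubset_refl.
  by rewrite (negbTE (noa _ lti)).
Qed.

Lemma cone_separated0 (s n : nat) : tri_separated s n -> cone_separated s n 0.
Proof.
move=> ok; have aK := tri_apex ok; have [cK vP noe] := ok.
split; rewrite ?cone_tri0 //.
- exact: cone_complex.
- move=> i j k; rewrite cone_vertex // => /orP[/eqP | /vP]; first by constructor 2.
  by constructor 1.
- move=> i j /andP[lij ljn]; rewrite in_cone // mem_fsetD1 ?noe //.
  by rewrite !inE !(inj_eq orig_inj); lia.
Qed.

Lemma cone_separatedP (s n m : nat) : (0 < s)%N -> tri_separated s n -> (m <= n)%N ->
  cone_separated s n m /\
  fresh_tower s (edge_label s) (cone (orig n) (simplex_tri s n))
    [seq (i, n) | i <- iota 0 m].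
Proof.
move=> s_gt0 ok; elim: m => [|m IH] lem; first by split=> //; apply: cone_separated0.
have [okm tw] := IH (ltnW lem); split; first exact: cone_separatedS.
rewrite -addn1 iotaD map_cat tower_cat; split=> //=; split=> //.
exact: cone_fresh.
Qed.

Lemma tri_separatedP (s n : nat) : (0 < s)%N ->
  tri_separated s n /\ fresh_tower s (edge_label s) (simplex n) (simplex_edges n).
Proof.
move=> s_gt0; elim: n => [|n [ok tw]].
  split=> //; split.
  - exact: simplex_complex.
  - by move=> i j k /(simplexP 0)/(_ (i, j, k)); rewrite inE eqxx => /(_ isT)[].
  - move=> i j _; apply/negP => /(simplexP 0)/(_ (orig i)).
    by rewrite !inE eqxx => /(_ isT)[].
have [twC triC] : fresh_tower s (edge_label s) (simplex n.+1) (simplex_edges n) /\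
   subdivide_all s (edge_label s) (simplex n.+1) (simplex_edges n) =
   cone (orig n) (simplex_tri s n).
  apply: tower_cone => //; [exact: simplex_complex | exact: simplex_apex |].
  move=> [i j] k; rewrite mem_simplex_edges /= => lij lek.
  by rewrite /edge_label; do ?case: ifP => _; apply/eqP => -[] /=; lia.
have triE : simplex_tri s n.+1 = cone_tri s n n.
  rewrite /simplex_tri /= /subdivide_all foldl_cat; move: triC.
  by rewrite /subdivide_all => ->.
have [okn twn] := cone_separatedP s_gt0 ok (leqnn n).
split; last by rewrite /= tower_cat triC.
have [cK vP noe noa] := okn; rewrite /tri_separated triE; split=> //.
- by move=> i j k /vP[|[]|]; lia.
- move=> i j lij; have [ltjn | lenj] := ltnP j n; first by apply: noe; rewrite lij.
  have [jn | jn] := eqVneq j n; first by rewrite jn; apply: noa; rewrite -jn.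
  apply/negP => /(complex_mem cK)/(_ (fset22 _ _))/vP[|[]|]; lia.
Qed.

Lemma simplex_triS (s n : nat) : (0 < s)%N ->
  simplex_tri s n.+1 = cone_tri s n n.
Proof.
move=> s_gt0; have [_ tw] := tri_separatedP n s_gt0.
rewrite /simplex_tri /= /subdivide_all foldl_cat.
have [|_] := tower_cone s_gt0 (simplex_complex n) (simplex_apex n) _ tw; last first.
  by rewrite /subdivide_all => ->.
move=> [i j] k; rewrite mem_simplex_edges /= => lij lek.
by rewrite /edge_label; do ?case: ifP => _; apply/eqP => -[] /=; lia.
Qed.

Lemma simplex_tri_triangulation (s n : nat) : (0 < s)%N ->
  tchebyshev_triangulation s (simplex n) (simplex_tri s n).
Proof.
move=> s_gt0; apply: tower_triangulation => //.
- exact: simplex_complex.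
- exact: (tri_separatedP n s_gt0).2.
- exact: simplex_edges_uniq.
- exact: simplex_edges_mem.
Qed.

Definition orig_linkpoly (R : nzRingType) (t : R) (s n : nat) : R :=
  \sum_(0 <= i < n) linkpoly t (simplex_tri s n) [fset orig i].

(** Subdividing the edge from [orig m] to the apex changes no link polynomial of
    another original vertex or of another edge through the apex, since
    [orig m] is adjacent to no other original vertex of the base; and it
    preserves those of its own two ends.  So all of them stay equal to their
    values in the cone. *)
Lemma cone_tri_linkpoly (R : comNzRingType) (t : R) (s n m : nat) :
  (0 < s)%N -> (m <= n)%N ->
  let K := simplex_tri s n in let K' := cone_tri s n m in
  [/\ forall i, (m <= i < n)%N ->
        linkpoly t K' [fset orig i; orig n] = linkpoly t K [fset orig i],
      forall i, (i < n)%N ->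
        linkpoly t K' [fset orig i] = (1 + t) * linkpoly t K [fset orig i],
      linkpoly t K' [fset orig n] = linkpoly t K fset0
    & linkpoly t K' fset0 = (1 + t) * linkpoly t K fset0 +
        s%:R * (t * (1 + t)) * \sum_(0 <= i < m) linkpoly t K [fset orig i]].
Proof.
move=> s_gt0 + K /=; have [ok _] := tri_separatedP n s_gt0.
have [aK [cK _ _]] := (tri_apex ok, ok).
elim: m => [|m IH] lem.
  rewrite cone_tri0; split.
  - move=> i lti; rewrite fsetUC linkpoly_cone_apex // !inE (inj_eq orig_inj); lia.
  - move=> i lti; rewrite linkpoly_cone // !inE (inj_eq orig_inj); lia.
  - by rewrite -(fsetU0 [fset orig n]) linkpoly_cone_apex.
  - by rewrite linkpoly_cone // big_geq // mulr0 addr0.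
have [okm _] := cone_separatedP s_gt0 ok (ltnW lem); have fg := cone_fresh okm lem.
have [cM _ noe _] := okm.
have [Li Lo La L0] := IH (ltnW lem); rewrite cone_triS.
have far i rho : (i < n)%N -> i != m -> orig i \in rho ->
    rho `<=` [fset orig i; orig n] ->
    linkpoly t (subdivide s (cone_tri s n m) (edge_label s (m, n))) rho =
    linkpoly t (cone_tri s n m) rho.
  move=> lti im ir /fsubsetP sub; apply: linkpoly_subdivide_far => //.
    move=> k ltk; apply/negP => /sub; rewrite !inE.
    by rewrite !orig_not_interior.
  rewrite split_edge_label.
  apply: contraNN (noe (minn i m) (maxn i m) ltac:(lia)) => KE.
  apply: cM.2 KE _; rewrite fsubUset !fsub1set !inE !(inj_eq orig_inj).
  by case: leqP => _; rewrite eqxx ir ?orbT.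
split.
- by move=> i lti; rewrite (far i) ?Li // ?inE ?eqxx //; lia.
- move=> i lti; rewrite -Lo //; have [-> | im] := eqVneq i m.
    by rewrite linkpoly_subdivide_end // split_edge_label !inE eqxx.
  by apply: (far i); rewrite ?inE // fsub1set !inE eqxx.
- by rewrite linkpoly_subdivide_end // split_edge_label !inE eqxx orbT.
- rewrite facepoly_subdivide // L0 split_edge_label Li ?leqnn ?lem //.
  by rewrite big_nat_recr //=; ring.
Qed.

Lemma simplex_tri_facepolyS (R : comNzRingType) (t : R) (s n : nat) :
  (0 < s)%N ->
  linkpoly t (simplex_tri s n.+1) fset0 =
  (1 + t) * linkpoly t (simplex_tri s n) fset0 +
  s%:R * (t * (1 + t)) * orig_linkpoly t s n.
Proof.
by move=> s_gt0; rewrite simplex_triS //; case: (cone_tri_linkpoly t s_gt0 (leqnn n)).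
Qed.

Lemma orig_linkpolyS (R : comNzRingType) (t : R) (s n : nat) :
  (0 < s)%N ->
  orig_linkpoly t s n.+1 =
  (1 + t) * orig_linkpoly t s n + linkpoly t (simplex_tri s n) fset0.
Proof.
move=> s_gt0; have [_ Lo La _] := cone_tri_linkpoly t s_gt0 (leqnn n).
rewrite /orig_linkpoly simplex_triS // big_nat_recr //= La mulr_sumr; congr (_ + _).
by apply: eq_big_nat => i /Lo.
Qed.

Lemma simplex_facepoly (R : nzRingType) (t : R) (n : nat) :
  linkpoly t (simplex n) fset0 = (1 + t) ^+ n.
Proof.
elim: n => [|n IH] /=; last first.
  by rewrite linkpoly_cone ?IH ?exprS //; [exact: simplex_complex | exact: simplex_apex].
by rewrite /linkpoly big_mkcond big_seq_fset1 fsubset_refl cardfs0.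
Qed.

Lemma simplex_tri0_facepoly (R : nzRingType) (t : R) (s : nat) :
  linkpoly t (simplex_tri s 0) fset0 = 1.
Proof. exact: (simplex_facepoly t 0). Qed.

Lemma Fpoly_linkpoly (R : realType) (V : choiceType) (K : {fset {fset V}}) :
  Fpoly R K = linkpoly (2^-1 *: ('X - 1) : {poly R}) K fset0.
Proof.
rewrite /Fpoly /linkpoly; set u := _ *: _.
under [RHS]eq_bigl do rewrite fsub0set.
under [RHS]eq_bigr do rewrite cardfs0 subn0.
transitivity (\sum_(0 <= j < (dim1 K).+1)
    \sum_(rho <- K | #|` rho| == j) u ^+ #|` rho|).
  apply: eq_bigr => j _; rewrite (eq_bigr (fun=> u ^+ j)) => [|rho /eqP-> //].
  rewrite big_fset_condE /= -big_filter big_const_seq count_predT.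
  rewrite iter_addr_0 scaler_nat /fnum; congr (_ *+ _).
  by rewrite filter_predT.
rewrite (exchange_big_dep xpredT) //=; rewrite big_seq [RHS]big_seq.
apply: eq_bigr => rho Kr; under eq_bigl do rewrite eq_sym.
rewrite big_nat1_eq ltnS ifT //.
exact: (@leq_bigmax_seq {fset V} (enum_fset K) predT
          (fun sigma => #|` sigma|) rho Kr).
Qed.

(** * Values of the Tchebyshev map *)

From mathcomp Require Import trigo complex.

(** The variable (x - 1) / 2 in which the F-polynomial is the f-polynomial. *)
Definition face_variable (R : realType) : {poly R} := 2^-1 *: ('X - 1).

Lemma size_face_variable (R : realType) : (size (face_variable R) <= 2)%N.
Proof. by rewrite (leq_trans (size_scale_leq _ _)) // size_XsubC. Qed.

Lemma size_mul_bound (R : nzRingType) (p q : {poly R}) (m k : nat) :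
  (size p <= m.+1)%N -> (size q <= k)%N -> (size (p * q)%R <= m + k)%N.
Proof.
move=> lep leq; apply: leq_trans (size_polyMleq p q) _.
by move: (size p) (size q) lep leq => a b; lia.
Qed.

Lemma size_add_bound (R : nzRingType) (p q : {poly R}) (m : nat) :
  (size p <= m)%N -> (size q <= m)%N -> (size (p + q)%R <= m)%N.
Proof. by move=> lep leq; rewrite (leq_trans (size_polyD _ _)) // geq_max lep. Qed.

Lemma size_simplex_tri (R : realType) (s n : nat) : (0 < s)%N ->
  (size (linkpoly (face_variable R) (simplex_tri s n) fset0) <= n.+1)%N /\
  (size (orig_linkpoly (face_variable R) s n) <= n)%N.
Proof.
move=> s_gt0; have szw := size_face_variable R.
have sz1 : (size (1 + face_variable R)%R <= 2)%N.
  by apply: size_add_bound; rewrite ?size_poly1.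
elim: n => [|n [IHP IHQ]].
  by rewrite simplex_tri0_facepoly size_poly1 /orig_linkpoly big_geq // size_poly0.
rewrite simplex_tri_facepolyS // orig_linkpolyS //; split; apply: size_add_bound => //.
- by have := size_mul_bound sz1 IHP.
- apply: (@size_mul_bound _ _ _ 2) => //.
  rewrite -polyC_natr mul_polyC (leq_trans (size_scale_leq _ _)) //.
  by have := size_mul_bound szw sz1.
- by have := size_mul_bound sz1 IHQ.
Qed.

(** The recurrences for the face polynomial and for the sum of link polynomials
    are multiplication by (1 + x + i r) / 2, because t (1 + t) equals
    (x ^ 2 - 1) / 4 for t = (x - 1) / 2. *)
Lemma simplex_tri_eval (R : realType) (s n : nat) (x r : R) : (0 < s)%N ->
  r ^+ 2 = s%:R * (1 - x ^+ 2) ->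
  Complex (linkpoly (face_variable R) (simplex_tri s n) fset0).[x]
          (r / 2 * (orig_linkpoly (face_variable R) s n).[x]) =
  Complex ((1 + x) / 2) (r / 2) ^+ n.
Proof.
move=> s_gt0 r2; elim: n => [|n IH].
  by rewrite simplex_tri0_facepoly /orig_linkpoly big_geq // !hornerE ?mulr0 expr0.
rewrite exprS -IH simplex_tri_facepolyS // orig_linkpolyS //.
set P := linkpoly _ _ _; set Q := orig_linkpoly _ _ _.
have wE : (face_variable R).[x] = (x - 1) / 2 by rewrite !hornerE mulrC.
have oneE : (1 : {poly R}).[x] = 1 by rewrite hornerE.
have sE : (s%:R : {poly R}).[x] = s%:R by rewrite -polyC_natr hornerC.
rewrite !(hornerD, hornerM) wE oneE sE.
apply/eqP; rewrite eq_complex; apply/andP; split; apply/eqP => /=; last by field.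
by transitivity ((1 + x) / 2 * P.[x] - r ^+ 2 / 4 * Q.[x]); [rewrite r2 |]; field.
Qed.

Lemma tchebyshev_map_simplex (R : realType) (s n : nat)
    (T : {linear {poly R} -> {poly R}}) :
  (0 < s)%N -> tchebyshev_map s T ->
  T ((1 + face_variable R) ^+ n) =
  linkpoly (face_variable R) (simplex_tri s n) fset0.
Proof.
move=> s_gt0 hT; rewrite -simplex_facepoly -!Fpoly_linkpoly.
by apply: hT; [exact: simplex_complex | exact: simplex_tri_triangulation].
Qed.

(** Trades a factor x for factors (1 + x) / 2, whose powers are F-polynomials of
    simplices. *)
Lemma powX_recurrence (R : realType) (a b : nat) :
  (1 + face_variable R) ^+ a * 'X^(b.+1) =
  2 *: ((1 + face_variable R) ^+ a.+1 * 'X^b) - (1 + face_variable R) ^+ a * 'X^b.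
Proof.
have XE : 'X = 2 *: (1 + face_variable R) - 1 :> {poly R}.
  rewrite /face_variable scalerDr scalerA mulfV ?pnatr_eq0 // scale1r.
  by rewrite -mul_polyC; ring.
by rewrite !exprS {1}XE -!mul_polyC; ring.
Qed.

(** By induction on [n], for all products of a power of (1 + x) / 2 with x ^ n. *)
Lemma tchebyshev_map_eval (R : realType) (s : nat)
    (T : {linear {poly R} -> {poly R}}) (x r : R) :
  (0 < s)%N -> tchebyshev_map s T -> r ^+ 2 = s%:R * (1 - x ^+ 2) ->
  forall n, (T 'X^n).[x] = complex.Re (Complex x r ^+ n).
Proof.
move=> s_gt0 hT r2 n.
suff evalE a : (T ((1 + face_variable R) ^+ a * 'X^n)).[x] =
    complex.Re (Complex ((1 + x) / 2) (r / 2) ^+ a * Complex x r ^+ n).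
  by have := evalE 0%N; rewrite !expr0 !mul1r.
elim: n a => [|n IH] a.
  rewrite !expr0 !mulr1.
  by rewrite (tchebyshev_map_simplex a s_gt0 hT) -(simplex_tri_eval a s_gt0 r2).
rewrite powX_recurrence linearB linearZ /= !hornerE !IH.
set w := Complex _ _; set z := Complex _ _.
have zE : z = w + w - 1.
  by apply/eqP; rewrite eq_complex /=; apply/andP; split; apply/eqP; field.
have -> : w ^+ a * z ^+ n.+1 =
    w ^+ a.+1 * z ^+ n + w ^+ a.+1 * z ^+ n - w ^+ a * z ^+ n.
  by rewrite !exprS {1}zE; ring.
by rewrite !raddfB !raddfD /=; ring.
Qed.

Lemma tchebyshev_map_size (R : realType) (s n : nat)
    (T : {linear {poly R} -> {poly R}}) :
  (0 < s)%N -> tchebyshev_map s T -> (size (T 'X^n) <= n.+1)%N.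
Proof.
move=> s_gt0 hT.
suff sizeE a : (size (T ((1 + face_variable R) ^+ a * 'X^n)%R) <= (a + n).+1)%N.
  by have := sizeE 0%N; rewrite expr0 mul1r.
elim: n a => [|n IH] a.
  rewrite expr0 mulr1 addn0 (tchebyshev_map_simplex a s_gt0 hT).
  by case: (size_simplex_tri R a s_gt0).
rewrite powX_recurrence linearB linearZ /=; apply: size_add_bound.
  by rewrite (leq_trans (size_scale_leq _ _)) // addnS -addSn IH.
by rewrite size_polyN (leq_trans (IH a)) // addnS.
Qed.

Lemma de_moivre (R : realType) (rho a : R) (n : nat) :
  Complex (rho * cos a) (rho * sin a) ^+ n =
  Complex (rho ^+ n * cos (n%:R * a)) (rho ^+ n * sin (n%:R * a)).
Proof.
elim: n => [|n IH]; first by rewrite !expr0 mul0r cos0 sin0 mulr1 mulr0.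
rewrite exprS IH -natr1 mulrDl mul1r cosD sinD exprS.
by apply/eqP; rewrite eq_complex /=; apply/andP; split; apply/eqP; ring.
Qed.

(** * Roots *)

(** The polar radius, in the direction [a], of the ellipse
    r ^ 2 = s (1 - x ^ 2), found by substituting x = rho cos a and
    r = rho sin a. *)
Definition radius (R : realType) (s : nat) (a : R) : R :=
  Num.sqrt (s%:R / (s%:R * cos a ^+ 2 + sin a ^+ 2)).

Lemma radius_denom_gt0 (R : realType) (s : nat) (a : R) :
  (0 < s)%N -> 0 < s%:R * cos a ^+ 2 + sin a ^+ 2.
Proof.
move=> s_gt0; have := cos2Dsin2 a; have : 1 <= s%:R :> R by rewrite ler1n.
by have := sqr_ge0 (cos a); have := sqr_ge0 (sin a); nra.
Qed.

Lemma radius_gt0 (R : realType) (s : nat) (a : R) :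
  (0 < s)%N -> 0 < radius s a.
Proof. by move=> s_gt0; rewrite sqrtr_gt0 divr_gt0 ?ltr0n ?radius_denom_gt0. Qed.

Lemma radius_sqr (R : realType) (s : nat) (a : R) :
  (0 < s)%N -> radius s a ^+ 2 = s%:R / (s%:R * cos a ^+ 2 + sin a ^+ 2).
Proof.
by move=> s_gt0; rewrite sqr_sqrtr // divr_ge0 ?ler0n // ltW ?radius_denom_gt0.
Qed.

Lemma radius_ellipse (R : realType) (s : nat) (a : R) : (0 < s)%N ->
  (radius s a * sin a) ^+ 2 = s%:R * (1 - (radius s a * cos a) ^+ 2).
Proof.
move=> s_gt0; rewrite !exprMn radius_sqr //.
have D0 : s%:R * cos a ^+ 2 + sin a ^+ 2 != 0 by rewrite gt_eqF ?radius_denom_gt0.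
by field.
Qed.

(** The radius is a function of the abscissa, as rho ^ 2 = x ^ 2 + r ^ 2, and
    then so is the cosine. *)
Lemma radius_cos_inj (R : realType) (s : nat) (a b : R) : (0 < s)%N ->
  radius s a * cos a = radius s b * cos b -> cos a = cos b.
Proof.
move=> s_gt0 eq_ab.
have eq_r : radius s a = radius s b.
  apply/eqP; rewrite -(eqrXn2 (ltn0Sn 1)) ?ltW ?radius_gt0 //; apply/eqP.
  have rE c : radius s c ^+ 2 = s%:R - (s%:R - 1) * (radius s c * cos c) ^+ 2.
    have := radius_ellipse c s_gt0; rewrite !exprMn sin2cos2 => E.
    have := E; lra.
  by rewrite !rE eq_ab.
by move: eq_ab; rewrite eq_r; apply: mulfI; rewrite gt_eqF ?radius_gt0.
Qed.

Definition node (R : realType) (n k : nat) : R :=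
  (k%:R *+ 2 + 1) / n%:R * (pi / 2).

Lemma node_bounds (R : realType) (n k : nat) : (k < n)%N ->
  0 < node R n k < pi.
Proof.
move=> ltk; have n_gt0 : 0 < n%:R :> R by rewrite ltr0n; case: n ltk.
have pi0 := pi_gt0 R; have lekn : k%:R + 1 <= n%:R :> R by rewrite natr1 ler_nat.
have k0 : 0 <= k%:R :> R by [].
have fr0 : 0 < (k%:R *+ 2 + 1) / n%:R :> R by rewrite divr_gt0 // -mulr_natl; lra.
have fr2 : (k%:R *+ 2 + 1) / n%:R < 2 :> R.
  by rewrite ltr_pdivrMr // -mulr_natl; lra.
by rewrite /node; apply/andP; split; nra.
Qed.

Lemma node_inj (R : realType) (n k l : nat) : (0 < n)%N ->
  node R n k = node R n l -> k = l.
Proof.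
move=> n_gt0; have pi2 : pi / 2 != 0 :> R by rewrite gt_eqF ?divr_gt0 ?pi_gt0.
have n0 : (n%:R)^-1 != 0 :> R by rewrite invr_eq0 pnatr_eq0 -lt0n.
move/(mulIf pi2)/(mulIf n0)/addIr/eqP; rewrite eqrMn2r //= eqr_nat.
by move/eqP.
Qed.

Lemma cos_node (R : realType) (n k : nat) : (0 < n)%N ->
  cos (n%:R * node R n k) = 0.
Proof.
move=> n_gt0; have n0 : n%:R != 0 :> R by rewrite pnatr_eq0 -lt0n.
have -> : n%:R * node R n k = k%:R * pi + pi / 2 by rewrite /node; field.
rewrite cosDpihalf; elim: k => [|k IH]; first by rewrite mul0r sin0 oppr0.
by rewrite -natr1 mulrDl mul1r sinDpi IH oppr0.
Qed.

(** In the open upper half plane r is nonzero, so 1 - x ^ 2 is positive. *)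
Lemma radius_cos_bounds (R : realType) (s : nat) (a : R) : (0 < s)%N ->
  0 < a < pi -> -1 < radius s a * cos a < 1.
Proof.
move=> s_gt0 a_bd; have s1 : 0 < s%:R :> R by rewrite ltr0n.
have : 0 < (radius s a * sin a) ^+ 2.
  by rewrite exprn_gt0 // mulr_gt0 ?radius_gt0 ?sin_gt0_pi.
rewrite radius_ellipse // pmulr_rgt0 // subr_gt0 => x2.
by apply/andP; split; nra.
Qed.

(** At x = 1 the imaginary part r vanishes, and the value is 1. *)
Lemma tchebyshev_map_neq0 (R : realType) (s n : nat)
    (T : {linear {poly R} -> {poly R}}) :
  (0 < s)%N -> tchebyshev_map s T -> T 'X^n != 0.
Proof.
move=> s_gt0 hT.
have r0 : (0 : R) ^+ 2 = s%:R * (1 - 1 ^+ 2) by rewrite expr1n subrr mulr0 expr0n.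
have := tchebyshev_map_eval s_gt0 hT r0 n.
have -> : Complex 1 0 = 1 :> complex R by apply/eqP; rewrite eq_complex /= !eqxx.
rewrite expr1n /= => eval1.
by apply: contra_eq_neq eval1 => ->; rewrite horner0 eq_sym oner_eq0.
Qed.

Theorem proposition6p1 (R : realType) (s : nat) (hs : (1 <= s)%N)
    (T : {linear {poly R} -> {poly R}}) (hT : tchebyshev_map s T) (n : nat) :
  exists rs : seq R,
    [/\ size rs = n,
        uniq rs
      & forall x : R, (x \in rs) = (-1 < x < 1) && root (T 'X^n) x].
Proof.
pose rt k := radius s (node R n k) * cos (node R n k).
pose rs := [seq rt k | k <- iota 0 n].
have rs_uniq : uniq rs.
  rewrite map_inj_in_uniq ?iota_uniq // => k l; rewrite !mem_iota => /= ltk ltl.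
  move=> /(radius_cos_inj hs) eq_cos.
  have bd i : (i < n)%N -> node R n i \in `[0, pi].
    by move=> /(@node_bounds R)/andP[lo hi]; rewrite in_itv /= !ltW.
  apply: (@node_inj R n); last exact: cos_inj (bd _ ltk) (bd _ ltl) eq_cos.
  exact: leq_ltn_trans (leq0n k) ltk.
have rs_root x : x \in rs -> (-1 < x < 1) && root (T 'X^n) x.
  case/mapP => k; rewrite mem_iota => /= ltk ->.
  rewrite radius_cos_bounds ?node_bounds //=.
  rewrite /root (tchebyshev_map_eval hs hT (radius_ellipse _ hs)) de_moivre /=.
  by rewrite cos_node ?mulr0 // (leq_ltn_trans (leq0n k)).
exists rs; split=> [|//|x]; first by rewrite size_map size_iota.
apply/idP/andP => [/rs_root/andP // | [_ rx]].
case: (boolP (x \in rs)) => // x_rs; exfalso.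
have roots : all (root (T 'X^n)) (x :: rs).
  by rewrite /= rx; apply/allP => y /rs_root/andP[].
have := max_poly_roots (tchebyshev_map_neq0 n hs hT) roots.
rewrite /= x_rs rs_uniq size_map size_iota => /(_ isT).
by rewrite ltnNge (leq_trans (tchebyshev_map_size n hs hT)).
Qed.
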